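(* Let $r\geq 3$ and $n\geq 2r+2$ be integers. If $\mathcal{H}\subseteq\binom{[n]}{r}$ is an intersecting $r$-uniform hypergraph, then $\sigma_r(\mathcal{H})\leq r\binom{n-2}{r-2}$. Moreover, equality holds only when $\mathcal{H}$ is a $1$-star.
   Context: An $r$-uniform hypergraph $\mathcal{H}\subseteq\binom{[n]}{r}$ on vertex set $[n]=\{1,\dots,n\}$ is a family of $r$-subsets of $[n]$ (its edges). The degree $\deg(v)$ of a vertex $v$ is the number of edges containing $v$. For an $r$-set $S\subseteq[n]$, $\deg(S)=\sum_{v\in S}\deg(v)$. The Ore-degree $\sigma_r(\mathcal{H})$ is the minimum of $\deg(S)$ over all $r$-subsets $S\subseteq[n]$ with $S\notin\mathcal{H}$. $\mathcal{H}$ is intersecting if every two edges have nonempty intersection. A $1$-star is the hypergraph consisting of all $r$-subsets of $[n]$ containing a fixed vertex $x\in[n]$. *)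

(* Defs.v *)
From mathcomp Require Import all_boot.

Set Implicit Arguments.
Unset Strict Implicit.
Unset Printing Implicit Defensive.

Section Hypergraph.

Variable n : nat.
Implicit Types (H : {set {set 'I_n}}) (S : {set 'I_n}) (v x : 'I_n).

Definition uniform (r : nat) H : Prop :=
  forall e, e \in H -> #|e| = r.

Definition intersecting H : Prop :=
  forall e f, e \in H -> f \in H -> e :&: f != set0.

Definition deg H v : nat := #|[set e in H | v \in e]|.

Definition degS H S : nat := \sum_(v in S) deg H v.

(* Every r-set S satisfies degS H S <= r * #|H|, so the initial value of the
   iterated minimum only matters when every r-set is an edge; see
   ore_degree_le and ore_degree_attained. *)
Definition ore_degree (r : nat) H : nat :=
  \big[minn/r * #|H|]_(S : {set 'I_n} | (#|S| == r) && (S \notin H)) degS H S.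

Definition is_star (r : nat) H : Prop :=
  exists x, H = [set e : {set 'I_n} | (#|e| == r) && (x \in e)].

Lemma ore_degree_le r H S :
  #|S| = r -> S \notin H -> ore_degree r H <= degS H S.
Proof.
move=> cS nS; rewrite /ore_degree.
have: S \in index_enum {set 'I_n} by rewrite mem_index_enum.
elim: (index_enum _) => [|T s IH] //; rewrite inE big_cons.
case/orP=> [/eqP<-|/IH le_s]; first by rewrite cS eqxx nS /= geq_minl.
by case: ifP => _ //; apply: leq_trans (geq_minr _ _) le_s.
Qed.

Lemma degS_le H S : degS H S <= #|S| * #|H|.
Proof.
rewrite /degS -sum_nat_const; apply: leq_sum => v _.
by apply: subset_leq_card; apply/subsetP => e; rewrite inE => /andP[].
Qed.

Lemma ore_degree_attained r H :
  (exists2 S : {set 'I_n}, #|S| = r & S \notin H) ->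
  exists S : {set 'I_n}, [/\ #|S| = r, S \notin H & ore_degree r H = degS H S].
Proof.
case=> S0 cS0 nS0.
have [|[S [cS nS eS]]] : ore_degree r H = r * #|H| \/
    exists S : {set 'I_n}, [/\ #|S| = r, S \notin H & ore_degree r H = degS H S].
- rewrite /ore_degree; elim/big_rec: _ => [|S m /andP[/eqP cS nS] IH].
    by left.
  by rewrite /minn; case: ltnP => // _; right; exists S.
- move=> e0; exists S0; split=> //; apply/eqP.
  by rewrite eqn_leq ore_degree_le //= e0 -cS0 degS_le.
- by exists S.
Qed.

End Hypergraph.

(* Main.v *)
Require Import Defs.
From mathcomp Require Import all_boot all_order all_algebra all_field.
From mathcomp Require Import ring lra zify.

Set Implicit Arguments.
Unset Strict Implicit.
Unset Printing Implicit Defensive.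

Import Order.TTheory GRing.Theory Num.Theory.

(**
Averaging deg(S) over the non-edges S reduces the bound to a lower estimate of
the sum of squared degrees.  That estimate says that, on the r-sets, the matrix
  [S and T disjoint] + mu [S = T] - al - be |S & T|
is positive semidefinite, where mu = C(n-r-3, r-3) is minus the fourth Kneser
eigenvalue and al, be make the matrix vanish on the first two eigenspaces.
An eigenvector f is analysed by the differences T |-> f(x + T) - f(y + T):
these intertwine the Kneser matrix on r-sets of an n-set with minus the Kneser
matrix on (r-1)-sets of an (n-2)-set, turn |S & T| into the all-ones matrix,
and kill the all-ones matrix.  Either f, or one of its first or second differences,
is a nonzero constant, which determines the eigenvalue, or a third difference
is a nonzero eigenvector, and the row sums of the Kneser matrix bound the
eigenvalue.

In the case of equality, |H| = C(n-1, r-1), all non-edges have the same degree,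
and not all vertices do; exchanging two vertices of different degrees then
shows that one of them lies in all edges.
*)

(** * Positivity of a symmetric form from its eigenvalues *)

Section Spectral.
Local Open Scope ring_scope.
Local Open Scope sesquilinear_scope.

(** By the spectral theorem over [algC], the form is a sum of squared moduli weighted by
    eigenvalues, which are real because the matrix is Hermitian. *)
Lemma symmetric_psd (T : finType) (K : T -> T -> rat) (v : T -> rat) :
    (forall s t, K s t = K t s) ->
    (forall (m : algC) (f : T -> algC), m \is Num.real ->
       (exists s, f s != 0) ->
       (forall s, \sum_t ratr (K s t) * f t = m * f s) -> 0 <= m) ->
  0 <= \sum_s \sum_t v s * K s t * v t.
Proof.
move=> symK eigK.
pose A : 'M[algC]_#|T| := \matrix_(i, j) ratr (K (enum_val i) (enum_val j)).
pose w : 'rV[algC]_#|T| := \row_i ratr (v (enum_val i)).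
have enum_valE (F : T -> algC) : \sum_t F t = \sum_(i < #|T|) F (enum_val i).
  rewrite (reindex (@enum_val T xpredT)) //=.
  by exists enum_rank => t _; rewrite ?enum_valK ?enum_rankK.
have realw : w^t* = w^T.
  by apply/matrixP=> i j; rewrite !mxE (CrealP (Creal_Crat (Crat_rat _))).
have hermA : A \is hermsymmx.
  apply: realsym_hermsym.
    by apply/is_hermitianmxP/matrixP=> i j; rewrite expr0 scale1r !mxE symK.
  by apply/mxOverP=> i j; rewrite !mxE; apply: Creal_Crat (Crat_rat _).
have defA := orthomx_spectralP (hermitian_normalmx hermA).
have Preal := hermitian_spectral_diag_real hermA.
have Punit := spectral_unitarymx A.
move: defA Preal Punit; set P := spectralmx A; set d := spectral_diag A.
move=> defA dreal uniP.
have PA : P *m A = diag_mx d *m P.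
  by rewrite {1}defA !mulmxA mulmxV ?mul1mx // unitarymx_unit.
(* Row [i] of [P] is an eigenvector by [PA], and is nonzero because rows of a unitary matrix have
   norm one. *)
have d_ge0 i : 0 <= d 0 i.
  apply: (eigK _ (fun t => P i (enum_rank t))); first by move/mxOverP: dreal.
    apply/existsP; apply: contraT; rewrite negb_exists => /forallP P0.
    have := row_unitarymxP uniP i i; rewrite eqxx dotmxE mxE big1 => [|j _].
      by move/eqP; rewrite eq_sym oner_eq0.
    have := P0 (enum_val j); rewrite negbK enum_valK => /eqP Pij.
    by rewrite !mxE Pij mul0r.
  move=> s; have := congr1 (fun M : 'M_#|T| => M i (enum_rank s)) PA.
  rewrite mul_diag_mx !mxE => <-.
  by rewrite enum_valE; apply: eq_bigr => j _; rewrite !mxE enum_valK enum_rankK symK mulrC.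
have : 0 <= (w *m A *m w^T) 0 0.
  rewrite {1}defA invmx_unitary // -realw !mulmxA.
  have -> : w *m P^t* *m diag_mx d *m P *m w^t* =
      (w *m P^t*) *m diag_mx d *m (w *m P^t*)^t*.
    by rewrite trmx_mul map_mxM trmxCK !mulmxA.
  rewrite !mxE; apply: sumr_ge0 => j _.
  by rewrite mul_mx_diag !mxE mulrAC; apply: mulr_ge0 (mul_conjC_ge0 _) (d_ge0 _).
suff -> : (w *m A *m w^T) 0 0 = ratr (\sum_s \sum_t v s * K s t * v t).
  by rewrite ler0q.
rewrite mxE rmorph_sum /= enum_valE.
under [RHS]eq_bigr => i _ do rewrite rmorph_sum enum_valE.
rewrite exchange_big /=; apply: eq_bigr => j _.
rewrite !mxE mulr_suml; apply: eq_bigr => i _.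
by rewrite !mxE !rmorphM.
Qed.

End Spectral.

(** * Kneser and overlap operators under swap differences *)

Section Kneser.
Variable V : finType.
Implicit Types (X S T U : {set V}) (x y : V) (k : nat).

(** [X] holds the points spent by earlier differences: the ground set shrinks while the type [V]
    stays fixed. *)
Definition ksets X k := [set S : {set V} | (#|S| == k) && [disjoint S & X]].

Lemma ksetsP X k S : reflect (#|S| = k /\ [disjoint S & X]) (S \in ksets X k).
Proof. by rewrite inE; apply: (iffP andP) => -[/eqP]. Qed.

Lemma card_ksets X k : #|ksets X k| = 'C(#|V| - #|X|, k).
Proof.
have <- : #|~: X| = #|V| - #|X| by rewrite -(cardsC X) addKn.
rewrite -cards_draws; apply: eq_card => S.
by rewrite !inE andbC disjoints_subset.
Qed.

Lemma disjointUl S T U : [disjoint S :|: T & U] = [disjoint S & U] && [disjoint T & U].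
Proof. by rewrite -!setI_eq0 setIUl setU_eq0. Qed.

Lemma disjointUr S T U : [disjoint U & S :|: T] = [disjoint U & S] && [disjoint U & T].
Proof. by rewrite -!setI_eq0 setIUr setU_eq0. Qed.

Lemma disjointx1 S x : [disjoint S & [set x]] = (x \notin S).
Proof. by rewrite disjoint_sym disjoints1. Qed.

Lemma card_ksets_disjoint X k S : S \in ksets X k ->
  #|[set T in ksets X k | [disjoint S & T]]| = 'C(#|V| - #|X| - k, k).
Proof.
case/ksetsP=> cS dS.
have -> : #|V| - #|X| - k = #|V| - #|X :|: S|.
  by rewrite cardsU -setI_eq0 in dS *; rewrite setIC (eqP dS) cards0 subn0 cS subnDA.
rewrite -card_ksets; apply: eq_card => T.
by rewrite !inE disjointUr [[disjoint T & S]]disjoint_sym andbA.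
Qed.

Local Open Scope ring_scope.
Implicit Type f : {set V} -> algC.

Definition kneser X k f S := \sum_(T in ksets X k | [disjoint S & T]) f T.
Definition overlap X k f S := \sum_(T in ksets X k) f T *+ #|S :&: T|.
Definition swapdiff x y f T := f (x |: T) - f (y |: T).

Lemma sum_ksets_split X k x y (P : pred {set V}) f :
  x != y -> x \notin X -> y \notin X ->
  \sum_(S in ksets X k.+1 | [&& x \in S, y \notin S & P (S :\ x)]) f S =
  \sum_(T in ksets (x |: (y |: X)) k | P T) f (x |: T).
Proof.
move=> nxy xX yX.
rewrite [RHS](reindex_onto (fun S => S :\ x) (fun T => x |: T)) /=; last first.
  move=> T /andP[/ksetsP[_]]; rewrite disjoint_sym disjointUl disjoints1.
  by case/andP=> xT _ _; rewrite setU1K.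
apply: eq_big => [S|S /andP[_ /andP[xS _]]]; last by rewrite setD1K.
apply/idP/idP.
- case/andP=> /ksetsP[cS dS] /and3P[xS yS PS]; rewrite PS setD1K // eqxx !andbT.
  apply/ksetsP; split; first by apply/eqP; rewrite -eqSS -cS (cardsD1 x S) xS.
  rewrite !disjointUr !disjointx1 !inE eqxx (negPf yS) andbF /=.
  by apply: disjointWl dS; rewrite subsetDl.
- case/andP=> /andP[/ksetsP[cS dS] PS] /eqP defS.
  have xS : x \in S by rewrite -defS setU11.
  move: dS; rewrite !disjointUr !disjointx1 !inE eq_sym nxy /= => /and3P[_ yS dS].
  rewrite xS yS PS !andbT; apply/andP; split.
    by rewrite (cardsD1 x) xS cS.
  by rewrite -defS disjointUl disjoints1 xX.
Qed.

(** Sets avoiding both [x] and [y] cancel. A remaining set disjoint from [x |: U] contains [y], and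
    conversely, which produces the minus sign. *)
Lemma kneser_swapdiff X k x y f U :
  x != y -> x \notin X -> y \notin X -> x \notin U -> y \notin U ->
  swapdiff x y (kneser X k.+1 f) U =
  - kneser (x |: (y |: X)) k (swapdiff x y f) U.
Proof.
move=> nxy xX yX xU yU.
pose Q := fun S => [disjoint U & S].
have split_in a b : a != b -> a \notin X -> b \notin X -> a \notin U -> b \notin U ->
  kneser X k.+1 f (a |: U) =
  \sum_(T in ksets (b |: (a |: X)) k | Q T) f (b |: T) +
  \sum_(T in ksets X k.+1 | [&& Q T, a \notin T & b \notin T]) f T.
  move=> nab aX bX aU bU; rewrite /kneser (bigID (fun T => b \in T)) /=; congr (_ + _).
    rewrite -sum_ksets_split // 1?eq_sym //; apply: eq_bigl => S.
    rewrite disjointUl disjoints1 -!andbA; congr (_ && _); rewrite /Q.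
    case bS: (b \in S); rewrite ?andbF //= andbT; congr (_ && _).
    by rewrite -[in LHS](setD1K bS) disjointUr disjointx1 bU.
  apply: eq_bigl => S; rewrite disjointUl disjoints1 -!andbA; congr (_ && _).
  by rewrite andbCA.
rewrite /swapdiff (split_in x y) // (split_in y x) 1?eq_sym //.
rewrite /kneser sumrB setUCA.
under [X in _ - (_ + X)]eq_bigl => S do rewrite [(y \notin S) && _]andbC.
by ring.
Qed.

(** The overlaps of [T] with [x |: U] and [y |: U] differ by [x in T] - [y in T], so only sets
    containing exactly one of the two points survive. *)
Lemma overlap_swapdiff X k x y f U :
  x != y -> x \notin X -> y \notin X -> x \notin U -> y \notin U ->
  swapdiff x y (overlap X k.+1 f) U =
  \sum_(T in ksets (x |: (y |: X)) k) swapdiff x y f T.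
Proof.
move=> nxy xX yX xU yU.
have cardI a T : a \notin U -> #|(a |: U) :&: T| = ((a \in T) + #|U :&: T|)%N.
  move=> aU; rewrite (cardsD1 a) !inE eqxx; congr (_ + _)%N.
  apply: eq_card => z; rewrite !inE; case: eqP => //= ->.
  by rewrite (negPf aU).
have splitE a b : a != b -> a \notin X -> b \notin X ->
  \sum_(T in ksets (a |: (b |: X)) k) f (a |: T) =
  \sum_(S in ksets X k.+1) (if (a \in S) && (b \notin S) then f S else 0).
  move=> nab aX bX; rewrite -big_mkcondr /=.
  transitivity (\sum_(T in ksets (a |: (b |: X)) k | predT T) f (a |: T)).
    by apply: eq_bigl => T; rewrite andbT.
  by rewrite -sum_ksets_split //; apply: eq_bigl => S; rewrite /= andbT.
rewrite /swapdiff /overlap [RHS]sumrB splitE // setUCA splitE 1?eq_sym //.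
rewrite -!sumrB; apply: eq_bigr => S _; rewrite !cardI // !mulrnDr.
by case: (x \in S) (y \in S) => -[] /=; ring.
Qed.

End Kneser.

(** * Eigenvalue bounds by iterated differences *)

Section SwapDifferences.
Variable V : finType.
Implicit Types (X S T U : {set V}) (x y : V) (k : nat).

Lemma ksetsU1 X k x y U : x \notin X -> U \in ksets (x |: (y |: X)) k ->
  x |: U \in ksets X k.+1.
Proof.
move=> xX /ksetsP[cU]; rewrite !disjointUr !disjointx1 => /and3P[xU yU dU].
by apply/ksetsP; split; rewrite ?cardsU1 ?xU ?cU // disjointUl disjoints1 xX.
Qed.

(** Single exchanges connect any two sets of equal size, by induction on the size of [S :\: T]. *)
Lemma ksets_swap_const (R : Type) (f : {set V} -> R) X k :
    (forall x y U, x != y -> x \notin X -> y \notin X ->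
       U \in ksets (x |: (y |: X)) k -> f (x |: U) = f (y |: U)) ->
  {in ksets X k.+1 &, forall S T, f S = f T}.
Proof.
move=> swapf S T; move cD : #|S :\: T| => d.
elim: d S cD => [|d IHd] S cD kS kT; move: (kS) (kT) => /ksetsP[cS dS] /ksetsP[cT dT].
  congr f; apply/eqP; rewrite eqEcard cS cT leqnn andbT.
  by rewrite -setD_eq0 -cards_eq0 cD.
have [x] : exists x, x \in S :\: T by apply/set0Pn; rewrite -cards_eq0 cD.
have [y] : exists y, y \in T :\: S.
  apply/set0Pn; rewrite -cards_eq0; have := cardsID T S; have := cardsID S T.
  by rewrite cS cT setIC cD; lia.
rewrite !inE => /andP[yS yT] /andP[xT xS].
have nxy : x != y by apply: contraNneq xT => ->.
have xX := disjointFr dS xS; have yX := disjointFr dT yT.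
have kU : S :\ x \in ksets (x |: (y |: X)) k.
  apply/ksetsP; split; first by have := cardsD1 x S; rewrite xS cS; lia.
  rewrite !disjointUr !disjointx1 !inE eqxx (negPf yS) andbF /=.
  by apply: disjointWl dS; rewrite subsetDl.
rewrite -(setD1K xS) (swapf x y) ?xX ?yX //; apply: IHd => //; last first.
  by apply: (@ksetsU1 _ _ _ x); rewrite ?yX // setUCA.
have -> : (y |: S :\ x) :\: T = (S :\: T) :\ x.
  apply/setP=> z; rewrite !inE; case: (eqVneq z y) => [->|_] /=; last by rewrite andbCA.
  by rewrite yT /= andbF.
by have := cardsD1 x (S :\: T); rewrite !inE xS xT cD; lia.
Qed.

Lemma card_ksets_mem X k v : v \notin X ->
  #|[set T in ksets X k.+1 | v \in T]| = 'C((#|V| - #|X|).-1, k).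
Proof.
move=> vX; have := cardsID [set T : {set V} | v \in T] (ksets X k.+1).
have -> : ksets X k.+1 :&: [set T : {set V} | v \in T] = [set T in ksets X k.+1 | v \in T].
  by apply/setP=> T; rewrite !inE.
have -> : ksets X k.+1 :\: [set T : {set V} | v \in T] = ksets (v |: X) k.+1.
  by apply/setP=> T; rewrite !inE disjointUr disjointx1 andbCA.
rewrite !card_ksets cardsU1 vX.
have ltX : #|X| < #|V|.
  by rewrite -[#|V|]cardsT; apply: proper_card; rewrite properE subsetT; apply/subsetPn; exists v.
have [q defq] : exists q, #|V| - #|X| = q.+1 by exists (#|V| - #|X|).-1; lia.
have -> : #|V| - (true + #|X|) = q by rewrite add1n subnS defq.
by rewrite defq binS addnC => /addnI.
Qed.

Lemma sum_card_ksetsI X k S : [disjoint S & X] ->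
  \sum_(T in ksets X k.+1) #|S :&: T| = #|S| * 'C((#|V| - #|X|).-1, k).
Proof.
move=> dS; rewrite -sum_nat_const.
transitivity (\sum_(T in ksets X k.+1) \sum_(v in S) (v \in T : nat)).
  apply: eq_bigr => T _; rewrite -sum1_card big_mkcond [RHS]big_mkcond /=.
  by apply: eq_bigr => v _; rewrite inE; case: (v \in S) (v \in T) => -[].
rewrite exchange_big /=; apply: eq_bigr => v vS.
rewrite -(@card_ksets_mem X _ v) ?(disjointFr dS vS) // -sum1_card.
by rewrite [LHS]big_mkcond [RHS]big_mkcond; apply: eq_bigr => T _; rewrite !inE; case: (_ && _) (v \in T) => -[].
Qed.

Local Open Scope ring_scope.
Implicit Types (f : {set V} -> algC) (a b c d : algC).

(** The eigenvalue equation with free coefficients for the Kneser, identity, all-ones and overlap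
    operators: a shape preserved by differences, under which (a, b, c, d) becomes (-a, b, d, 0). *)
Definition kneser_eqn a b c d X k f := {in ksets X k, forall S,
  a * kneser X k f S + b * f S + c * (\sum_(T in ksets X k) f T)
    + d * overlap X k f S = 0}.

Lemma kneser_eqn_swapdiff a b c d X k f x y :
  x != y -> x \notin X -> y \notin X -> kneser_eqn a b c d X k.+1 f ->
  kneser_eqn (- a) b d 0 (x |: (y |: X)) k (swapdiff x y f).
Proof.
move=> nxy xX yX eqf U kU.
have kyU : y |: U \in ksets X k.+1 by apply: (@ksetsU1 _ _ _ x); rewrite // setUCA.
have [] := ksetsP _ _ _ kU; rewrite !disjointUr !disjointx1 => _ /and3P[xU yU _].
rewrite -(overlap_swapdiff _ _ nxy xX yX xU yU) // mulNr -mulrN -kneser_swapdiff // /swapdiff.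
have := eqf _ (ksetsU1 xX kU); have := eqf _ kyU.
set A := kneser _ _ _ _; set A' := kneser _ _ _ (x |: _).
set B := overlap _ _ _ _; set B' := overlap _ _ _ (x |: _).
set s := \sum_(T in _) _ => E1 E2.
rewrite mul0r addr0 -[RHS](subr0 0) -{1}E2 -E1; ring.
Qed.

(** On a constant function each operator acts by its row sum. *)
Lemma kneser_eqn_const a b c d X k f S :
  kneser_eqn a b c d X k.+1 f -> {in ksets X k.+1 &, forall S T, f S = f T} ->
  S \in ksets X k.+1 -> f S != 0 ->
  a * 'C(#|V| - #|X| - k.+1, k.+1)%:R + b + c * 'C(#|V| - #|X|, k.+1)%:R
    + d * (k.+1 * 'C((#|V| - #|X|).-1, k))%:R = 0.
Proof.
move=> eqf constf kS nz; apply: (mulIf nz); rewrite mul0r -[RHS](eqf S kS).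
have [cS dS] := ksetsP _ _ _ kS.
have -> : kneser X k.+1 f S = f S *+ 'C(#|V| - #|X| - k.+1, k.+1).
  rewrite -(card_ksets_disjoint kS) -sumr_const; apply: eq_big => [T|T /andP[kT _]].
    by rewrite !inE.
  exact: constf.
have -> : \sum_(T in ksets X k.+1) f T = f S *+ 'C(#|V| - #|X|, k.+1).
  by rewrite -card_ksets -sumr_const; apply: eq_bigr => T kT; apply: constf.
have -> : overlap X k.+1 f S = f S *+ (k.+1 * 'C((#|V| - #|X|).-1, k)).
  rewrite -{2}cS -sum_card_ksetsI // -sumrMnr; apply: eq_bigr => T kT.
  by rewrite (constf T S).
by rewrite -![f S *+ _]mulr_natl; ring.
Qed.

(** Compare l1 norms: summing the triangle inequality over all [T] counts each value of |f| once per
    disjoint set, a constant number of times. *)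
Lemma kneser_eqn_bound a b X k f S :
  kneser_eqn a b 0 0 X k f -> S \in ksets X k -> f S != 0 ->
  `|b| <= `|a| * 'C(#|V| - #|X| - k, k)%:R.
Proof.
move=> eqf kS nz; pose s := \sum_(T in ksets X k) `|f T|.
have s_gt0 : 0 < s.
  rewrite /s (bigD1 S) //=; apply: ltr_wpDr; last by rewrite normr_gt0.
  by apply: sumr_ge0 => T _.
rewrite -(ler_pM2r s_gt0) -mulrA mulr_sumr.
have -> : 'C(#|V| - #|X| - k, k)%:R * s =
    \sum_(T in ksets X k) \sum_(U in ksets X k | [disjoint T & U]) `|f U|.
  rewrite (exchange_big_dep (mem (ksets X k))) /=; last by move=> T U _ /andP[].
  rewrite mulr_sumr; apply: eq_bigr => U kU.
  rewrite sumr_const mulr_natl; congr (_ *+ _).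
  rewrite -(card_ksets_disjoint kU); apply: eq_card => T.
  by rewrite [LHS]inE [RHS]inE kU /= disjoint_sym.
rewrite mulr_sumr; apply: ler_sum => T kT.
rewrite -normrM; have := eqf T kT; rewrite !mul0r !addr0 => /eqP.
rewrite addrC addr_eq0 => /eqP ->; rewrite normrN normrM.
by rewrite ler_wpM2l // ler_norm_sum.
Qed.

Lemma swapdiff_neq0_or_const X k f :
  (exists x y U, [/\ x != y, x \notin X, y \notin X,
     U \in ksets (x |: (y |: X)) k & swapdiff x y f U != 0]) \/
  {in ksets X k.+1 &, forall S T, f S = f T}.
Proof.
case: (boolP [exists x, exists y, exists U, [&& x != y, x \notin X, y \notin X,
    U \in ksets (x |: (y |: X)) k & swapdiff x y f U != 0]]).
  case/existsP=> x /existsP[y /existsP[U /and5P[? ? ? ? ?]]].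
  by left; exists x, y, U.
move=> nex; right; apply: ksets_swap_const => x y U nxy xX yX kU.
apply/eqP; rewrite -subr_eq0; apply: contraNT nex => nz.
apply/existsP; exists x; apply/existsP; exists y; apply/existsP; exists U.
by rewrite nxy xX yX kU.
Qed.

(** If [f] or its first or second difference is a nonzero constant, [m] is read off from row sums.
    Otherwise the third difference is nonzero and |mu - m| <= C(n-6-p, p) <= mu, so m >= 0. *)
Lemma kneser_eigenvalue_ge0 p f (m mu al be : algC) (n := #|V|) S :
  m \is Num.real -> S \in ksets set0 p.+3 -> f S != 0 ->
  kneser_eqn 1 (mu - m) (- al) (- be) set0 p.+3 f ->
  'C(n - 6 - p, p)%:R <= mu ->
  0 <= mu - 'C(n - 2 - p.+2, p.+2)%:R - be * 'C(n - 2, p.+2)%:R ->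
  0 <= 'C(n - p.+3, p.+3)%:R + mu - al * 'C(n, p.+3)%:R
       - be * (p.+3 * 'C(n.-1, p.+2))%:R ->
  0 <= m.
Proof.
move=> mR kS nzS eqf le3 le1 le0.
have mu_ge0 : 0 <= mu by apply: le_trans le3; rewrite ler0n.
have [[x1 [y1 [U1 [n1 x1X y1X kU1 nz1]]]]|cst] := swapdiff_neq0_or_const set0 p.+2 f; last first.
  have := kneser_eqn_const eqf cst kS nzS; rewrite cards0 subn0 -/n => E.
  suff -> : m = 'C(n - p.+3, p.+3)%:R + mu - al * 'C(n, p.+3)%:R
       - be * (p.+3 * 'C(n.-1, p.+2))%:R by [].
  by apply/eqP; rewrite -subr_eq0 -oppr_eq0 -[X in _ == X]E; apply/eqP; ring.
(* Each difference spends two points and lowers the set size by one: (n, p+3), (n-2, p+2), (n-4,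
   p+1), (n-6, p). *)
have eq1 := kneser_eqn_swapdiff n1 x1X y1X eqf.
set X1 := _ |: _ in kU1 eq1; set f1 := swapdiff _ _ _ in nz1 eq1.
have cX1 : #|X1| = 2 by rewrite !cardsU1 !inE orbF n1 cards0.
have [[x2 [y2 [U2 [n2 x2X y2X kU2 nz2]]]]|cst] := swapdiff_neq0_or_const X1 p.+1 f1; last first.
  have := kneser_eqn_const eq1 cst kU1 nz1; rewrite cX1 -/n => E.
  suff -> : m = mu - 'C(n - 2 - p.+2, p.+2)%:R - be * 'C(n - 2, p.+2)%:R by [].
  by apply/eqP; rewrite -subr_eq0 -oppr_eq0 -[X in _ == X]E; apply/eqP; ring.
have eq2 := kneser_eqn_swapdiff n2 x2X y2X eq1.
set X2 := _ |: _ in kU2 eq2; set f2 := swapdiff _ _ _ in nz2 eq2.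
have cX2 : #|X2| = 4 by rewrite cardsU1 cardsU1 cX1 in_setU1 negb_or n2 x2X y2X.
have [[x3 [y3 [U3 [n3 x3X y3X kU3 nz3]]]]|cst] := swapdiff_neq0_or_const X2 p f2; last first.
  have := kneser_eqn_const eq2 cst kU2 nz2; rewrite cX2 -/n => E.
  suff -> : m = 'C(n - 4 - p.+1, p.+1)%:R + mu by rewrite addr_ge0.
  by apply/eqP; rewrite -subr_eq0 -oppr_eq0 -[X in _ == X]E; apply/eqP; ring.
have := kneser_eqn_swapdiff n3 x3X y3X eq2.
set X3 := _ |: _ in kU3 *; set f3 := swapdiff _ _ _ in nz3 *.
have cX3 : #|X3| = 6 by rewrite cardsU1 cardsU1 cX2 in_setU1 negb_or n3 x3X y3X.
move=> eq3; have := kneser_eqn_bound eq3 kU3 nz3.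
rewrite cX3 -/n opprK normrN normr1 mul1r => /le_trans/(_ le3).
have muR : mu - m \is Num.real by rewrite realB // ger0_real.
by rewrite real_ler_norml // => /andP[_]; rewrite lerBlDr lerDl.
Qed.

End SwapDifferences.

(** * The quadratic form on an intersecting family *)

Section Family.
Variable n : nat.
Implicit Types (H : {set {set 'I_n}}) (S T : {set 'I_n}).

Lemma uniform_ksets r H S : uniform r H -> S \in H -> S \in ksets set0 r.
Proof. by move=> uH SH; apply/ksetsP; rewrite uH // -setI_eq0 setI0. Qed.

Lemma deg_sum H v : deg H v = \sum_(S in H) (v \in S : nat).
Proof.
rewrite /deg -sum1_card big_mkcond [RHS]big_mkcond; apply: eq_bigr => S _.
by rewrite inE; case: (S \in H) (v \in S) => -[].
Qed.

Lemma sum_card_setI H :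
  \sum_(S in H) \sum_(T in H) #|S :&: T| = \sum_v deg H v ^ 2.
Proof.
transitivity (\sum_(S in H) \sum_(T in H) \sum_v (v \in S) * (v \in T)).
  apply: eq_bigr => S _; apply: eq_bigr => T _.
  rewrite -sum1_card big_mkcond; apply: eq_bigr => v _.
  by rewrite inE; case: (v \in S) (v \in T) => -[].
under eq_bigr => S _ do rewrite exchange_big.
rewrite exchange_big; apply: eq_bigr => v _; rewrite -mulnn {1}deg_sum big_distrl /=.
by apply: eq_bigr => S _; rewrite deg_sum big_distrr.
Qed.

Local Open Scope ring_scope.

(** This is the form evaluated at the indicator of [H]; the disjointness term vanishes because [H]
    is intersecting. *)
Lemma intersecting_quadratic_ge0 p H (mu al be : rat) :
  uniform p.+3 H -> intersecting H ->
  'C(n - 6 - p, p)%:R <= mu ->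
  0 <= mu - 'C(n - 2 - p.+2, p.+2)%:R - be * 'C(n - 2, p.+2)%:R ->
  0 <= 'C(n - p.+3, p.+3)%:R + mu - al * 'C(n, p.+3)%:R
       - be * (p.+3 * 'C(n.-1, p.+2))%:R ->
  0 <= mu * #|H|%:R - al * #|H|%:R ^+ 2 - be * (\sum_v deg H v ^ 2)%:R.
Proof.
move=> uH iH le3 le1 le0; pose ks := ksets (set0 : {set 'I_n}) p.+3.
pose K0 S T : rat := [disjoint S & T]%:R + mu * (S == T)%:R - al - be * #|S :&: T|%:R.
(* Extension by zero to all subsets; it only adds the eigenvalue 0. *)
pose K S T : rat := if (S \in ks) && (T \in ks) then K0 S T else 0.
have symK S T : K S T = K T S.
  by rewrite /K /K0 andbC disjoint_sym eq_sym setIC.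
have := @symmetric_psd _ K (fun S => (S \in H)%:R) symK.
have -> : \sum_S \sum_T (S \in H)%:R * K S T * (T \in H)%:R =
    mu * #|H|%:R - al * #|H|%:R ^+ 2 - be * (\sum_v deg H v ^ 2)%:R.
  transitivity (\sum_(S in H) \sum_(T in H)
      (mu * (S == T)%:R - al - be * #|S :&: T|%:R)).
    rewrite [RHS]big_mkcond; apply: eq_bigr => S _; case: ifP => SH; last first.
      by rewrite big1 // => T _; rewrite !mul0r.
    rewrite [RHS]big_mkcond; apply: eq_bigr => T _; case: ifP => TH; last first.
      by rewrite mulr0.
    rewrite mul1r mulr1 /K /ks !(uniform_ksets uH) //= /K0.
    by rewrite -setI_eq0 (negPf (iH _ _ SH TH)) add0r.
  transitivity (\sum_(S in H) (mu - al *+ #|H| - be * (\sum_(T in H) #|S :&: T|)%:R)).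
    apply: eq_bigr => S SH; rewrite !sumrB sumr_const -!mulr_sumr natr_sum.
    congr (_ - _ - _); rewrite (bigD1 S) //= eqxx big1 ?addr0 ?mulr1 // => T.
    by case/andP=> _ /negPf; rewrite eq_sym => ->.
  rewrite !sumrB !sumr_const -mulr_sumr -natr_sum sum_card_setI.
  by rewrite -[mu *+ _]mulr_natr -[al *+ _ *+ _]mulr_natr -[al *+ _]mulr_natr; ring.
apply=> m f mR [S0 nz] eqf.
have [->//|m_neq0] := eqVneq m 0.
(* For m != 0 an eigenvector vanishes outside the r-sets, where the rows of [K] are zero. *)
have kS0 : S0 \in ks.
  apply: contraNT nz => kS0; have := eqf S0; rewrite big1 => [|T _].
    by move/esym/eqP; rewrite mulf_eq0 (negPf m_neq0).
  by rewrite /K (negPf kS0) rmorph0 mul0r.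
apply: (@kneser_eigenvalue_ge0 _ p f m (ratr mu) (ratr al) (ratr be) S0) => //.
- move=> S kS; move: (eqf S) => /eqP; rewrite -subr_eq0 => /eqP E; rewrite -[RHS]E.
  have -> : \sum_T ratr (K S T) * f T =
    \sum_(T in ks) ([disjoint S & T]%:R * f T + ratr mu * ((S == T)%:R * f T)
      - ratr al * f T - ratr be * (f T *+ #|S :&: T|)).
    rewrite [RHS]big_mkcond; apply: eq_bigr => T _; rewrite /K.
    rewrite [S \in ks]kS /=; case: (T \in ks); last by rewrite rmorph0 mul0r.
    rewrite /K0 !rmorphB rmorphD /= !rmorphM /= !ratr_nat -[f T *+ _]mulr_natr.
    by ring.
  rewrite !sumrB big_split /= -!mulr_sumr.
  have -> : \sum_(T in ks) [disjoint S & T]%:R * f T = kneser set0 p.+3 f S.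
    rewrite /kneser big_mkcondr; apply: eq_bigr => T _.
    by case: ifP => _; rewrite ?mul1r ?mul0r.
  have -> : \sum_(T in ks) (S == T)%:R * f T = f S.
    rewrite (bigD1 S) //= eqxx mul1r big1 ?addr0 // => T /andP[_ /negPf].
    by rewrite eq_sym => ->; rewrite mul0r.
  by rewrite /overlap; ring.
- by move: le3; rewrite card_ord -(ler_rat algC) ratr_nat.
- by move: le1; rewrite card_ord -(ler0q algC) !rmorphB rmorphM /= !ratr_nat.
- move: le0; rewrite card_ord -(ler0q algC) !rmorphB rmorphD 2!rmorphM /=.
  by rewrite !ratr_nat.
Qed.

End Family.

(** * The inequality between rational functions *)

Section Arith.
Local Open Scope ring_scope.

(** Binomials enter only through their ratios, so [field] can treat them as unknowns. Here [e] is
    the number of edges, [P] the sum of squared degrees, and [s] the slack in n >= 2r + 2. *)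
Lemma quadratic_average_bound (F : realFieldType) (p s N l M B c l0 mu al be e P : F)
    (r := p + 3) (n := 2 * p + 8 + s) :
  0 <= p -> 0 <= s -> 0 < N -> 0 < l -> e <= N ->
  M * r = n * N -> B * (n - 1) = N * (r - 1) -> c * (n - 1) = N * (n - r) ->
  l0 * r = (n - r) * l ->
  mu * ((n - r - 1) * (n - r - 2)) = l * ((r - 1) * (r - 2)) ->
  be * c = mu - l -> al * M = l0 + mu - be * (r * N) ->
  0 <= mu * e - al * e ^+ 2 - be * P ->
  r * e * N - P <= r * B * (M - e) /\ (e < N -> r * e * N - P < r * B * (M - e)).
Proof.
move=> p0 s0 N0 l_gt0 eN hM hB hc hl0 hmu hbe hal psd.
have r0 : 0 < r by rewrite /r; lra.
have n0 : 0 < n by rewrite /n; lra.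
have n1 : 0 < n - 1 by rewrite /n; lra.
have nr : 0 < n - r by rewrite /n /r; lra.
have nr1 : 0 < n - r - 1 by rewrite /n /r; lra.
have nr2 : 0 < n - r - 2 by rewrite /n /r; lra.
have n3 : 0 < n - 3 by rewrite /n; lra.
have n2r : 0 < n - 2 * r by rewrite /n /r; lra.
have r1 : 0 < r - 1 by rewrite /r; lra.
have r2 : 0 < r - 2 by rewrite /r; lra.
(* The factor of the slope [g1] whose sign is not evident; in [p] and [s] all its coefficients are
   positive. *)
pose Z := r * (n - 2) * (n - 3) * (n - 2 * r)
          - 2 * (n - r) * (n - r - 1) * (n - r - 2) + (n - 2 * r) * (r - 1) * (r - 2).
have Z0 : 0 < Z.
  have -> : Z = 4 * (p ^+ 3 * s) + 6 * p ^+ 3 + 4 * (p ^+ 2 * s ^+ 2)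
    + 37 * (p ^+ 2 * s) + 46 * p ^+ 2 + p * s ^+ 3 + 19 * (p * s ^+ 2) + 97 * (p * s)
    + 104 * p + s ^+ 3 + 15 * s ^+ 2 + 64 * s + 64 by rewrite /Z /r /n; ring.
  by apply: ltr_wpDl => //; rewrite !addr_ge0 // ?mulr_ge0 // ?exprn_ge0.
pose D := (n - r - 1) * (n - r - 2); pose Q := (r - 1) * (r - 2).
have D0 : 0 < D by rewrite mulr_gt0.
have Q0 : 0 < Q by rewrite mulr_gt0 //; lra.
(* With [P] replaced by its least value, the gap [r B (M - e) - (r e N - P)] is a
   convex quadratic in [e] vanishing at [e = N]; [- r N g1] is its slope there and
   [r A2] its leading coefficient. *)
pose g1 := (n - r) * Z / (n * r * (n - 1) * ((n - 3) * (n - 2 * r))).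
pose A2 := r / n + (n - r) * ((n - r) * D + r * Q)
                   / (r * n * (n - 1) * ((n - 3) * (n - 2 * r))).
have g1_gt0 : 0 < g1 by rewrite divr_gt0 ?mulr_gt0.
have A2_ge0 : 0 <= A2.
  have nDQ : 0 < (n - r) * D + r * Q by rewrite addr_gt0 ?mulr_gt0.
  by apply/ltW/addr_gt0; rewrite divr_gt0 ?mulr_gt0.
have c0 : 0 < c by rewrite -(pmulr_lgt0 _ n1) hc mulr_gt0.
have M0 : 0 < M by rewrite -(pmulr_lgt0 _ r0) hM mulr_gt0.
have muE : mu = l * Q / D by rewrite -hmu mulfK ?gt_eqF.
have lmuE : mu - l = - (l * ((n - 3) * (n - 2 * r)) / D).
  by rewrite muE /Q /D; field; rewrite !gt_eqF.
have be0 : be < 0.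
  by rewrite -(pmulr_llt0 _ c0) hbe lmuE oppr_lt0 divr_gt0 ?mulr_gt0.
(* Since be < 0, dividing the form by -be isolates [P]; the first summand is positive when e < N,
   which gives strictness. *)
have key : r * B * (M - e) - (r * e * N - P) =
    r * (N - e) * (g1 * N + A2 * (N - e)) + (mu * e - al * e ^+ 2 - be * P) / (- be).
  have -> : al = (l0 + mu - be * (r * N)) / M by rewrite -hal mulfK ?gt_eqF.
  have -> : be = (mu - l) / c by rewrite -hbe mulfK ?gt_eqF.
  rewrite lmuE muE.
  have -> : l0 = (n - r) * l / r by rewrite -hl0 mulfK ?gt_eqF.
  have -> : c = N * (n - r) / (n - 1) by rewrite -hc mulfK ?gt_eqF.
  have -> : M = n * N / r by rewrite -hM mulfK ?gt_eqF.
  have -> : B = N * (r - 1) / (n - 1) by rewrite -hB mulfK ?gt_eqF.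
  rewrite /g1 /A2 /Z /D /Q.
  by field; rewrite !gt_eqF.
have rest : 0 <= (mu * e - al * e ^+ 2 - be * P) / (- be).
  by rewrite divr_ge0 // oppr_ge0 ltW.
have Ne0 : 0 <= A2 * (N - e) by rewrite mulr_ge0 // subr_ge0.
have g1N : 0 < g1 * N by rewrite mulr_gt0.
have gA : 0 < g1 * N + A2 * (N - e) by apply: ltr_wpDr.
split=> [|lt_eN].
  rewrite -subr_ge0 key.
  by apply: addr_ge0 => //; apply: mulr_ge0 (ltW gA); rewrite mulr_ge0 ?subr_ge0 // ltW.
rewrite -subr_gt0 key.
by apply: ltr_wpDr => //; apply: mulr_gt0 gA; rewrite mulr_gt0 ?subr_gt0.
Qed.
End Arith.

(** * Bounds on the size and the squared degrees *)

Section Bounds.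
Variables (p n : nat) (H : {set {set 'I_n}}).
Hypotheses (le_n : 2 * p.+3 + 2 <= n) (uH : uniform p.+3 H) (iH : intersecting H).

(** With r = p+3, [M] counts all r-sets and [N] those of a star. [l0], -[l1] and -[mu] are the
    first, second and fourth Kneser eigenvalues; [c] is the overlap eigenvalue on the second
    eigenspace. *)
Let M := 'C(n, p.+3).
Let N := 'C(n.-1, p.+2).
Let B := 'C(n - 2, p.+1).
Let c := 'C(n - 2, p.+2).
Let l0 := 'C(n - p.+3, p.+3).
Let l1 := 'C(n - 2 - p.+2, p.+2).
Let mu := 'C(n - 6 - p, p).

Let binM : n * N = p.+3 * M. Proof. exact: mul_bin_diag. Qed.
Let binB : n.-1 * B = p.+2 * N. Proof. by rewrite /B subn2; apply: mul_bin_diag. Qed.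
Let binc : n.-1 * c = (n - p.+3) * N.
Proof. by rewrite /c subn2 mul_bin_down; congr (_ * _); lia. Qed.
Let binl0 : (n - p.+3) * l1 = p.+3 * l0.
Proof. by rewrite /l0 -mul_bin_diag /l1; congr (_ * 'C(_, _)); lia. Qed.
Let binmu : (n - p.+3 - 1) * (n - p.+3 - 2) * mu = (p.+2 * p.+1) * l1.
Proof.
have e1 := mul_bin_diag (n - 2 - p.+2) p.+1; have e2 := mul_bin_diag (n - 2 - p.+2).-1 p.
have -> : n - p.+3 - 1 = n - 2 - p.+2 by lia.
have -> : n - p.+3 - 2 = (n - 2 - p.+2).-1 by lia.
have -> : mu = 'C((n - 2 - p.+2).-2, p) by congr 'C(_, _); lia.
by rewrite -mulnA e2 mulnCA e1 mulnCA mulnA.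
Qed.

Let N_gt0 : 0 < N. Proof. by rewrite bin_gt0; lia. Qed.
Let l1_gt0 : 0 < l1. Proof. by rewrite bin_gt0; lia. Qed.
Let c_gt0 : 0 < c. Proof. by rewrite bin_gt0; lia. Qed.
Let M_gt0 : 0 < M. Proof. by rewrite bin_gt0; lia. Qed.

Local Notation "x %:q" := (x%:R : rat) (at level 2, format "x %:q").

(** The Erdos-Ko-Rado bound as a ratio bound: with be = 0, and [l1] in place of [mu], the form reads
    l1 e - (l1/N) e^2 >= 0 for e = |H|. *)
Lemma intersecting_card_le : #|H| <= N.
Proof.
have N0 : (0 < N%:q)%R by rewrite ltr0n.
have l0' : (0 < l1%:q)%R by rewrite ltr0n.
have hM := congr1 (fun k => k%:q) binM; have hl := congr1 (fun k => k%:q) binl0.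
rewrite !natrM in hM hl.
have := @intersecting_quadratic_ge0 n p H l1%:q (l1%:q / N%:q) 0 uH iH.
rewrite !mul0r !subr0 subrr lexx => psd.
suff: (0 <= l1%:q * #|H|%:q - l1%:q / N%:q * #|H|%:q ^+ 2)%R.
  rewrite expr2 -!mulrA -mulrBr pmulr_rge0 // -{1}[(#|H|%:q)%R]mul1r mulrA -mulrBl.
  case: (posnP #|H|) => [->//|H_gt0]; rewrite pmulr_lge0 ?ltr0n //.
  by rewrite subr_ge0 mulrC ler_pdivrMr // mul1r ler_nat.
apply: psd => //.
  rewrite ler_nat /l1.
  have -> : n - 2 - p.+2 = (n - 6 - p).+2 by lia.
  by rewrite !binS; lia.
rewrite -/l0 -/M.
have r0 : (0 < p.+3%:q)%R by rewrite ltr0n.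
have -> : (l0%:q = (n%:q - p.+3%:q) * l1%:q / p.+3%:q)%R.
  by rewrite -natrB ?hl 1?mulrC ?mulKf ?gt_eqF //; lia.
have -> : (M%:q = n%:q * N%:q / p.+3%:q)%R by rewrite hM mulrC mulKf ?gt_eqF.
move: r0 N0; move: (p.+3%:q)%R (N%:q)%R (n%:q)%R (l1%:q)%R => r' N' n' l' r0 N0.
rewrite le_eqVlt; apply/orP; left; apply/eqP; field.
by rewrite !gt_eqF.
Qed.

(** The squared degrees are added on the right to avoid truncated subtraction; M - |H| is exact. *)
Lemma intersecting_degree_squares :
  p.+3 * #|H| * N <= p.+3 * B * (M - #|H|) + \sum_v deg H v ^ 2 /\
  (p.+3 * #|H| * N = p.+3 * B * (M - #|H|) + \sum_v deg H v ^ 2 -> #|H| = N).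
Proof.
have eN := intersecting_card_le; have eM : #|H| <= M.
  by apply: leq_trans eN _; rewrite -(leq_pmul2l (isT : 0 < p.+3)) -binM leq_mul2r; lia.
pose s := n - (2 * p + 8); have defn : n = 2 * p + 8 + s by rewrite /s; lia.
(* [be] makes the form vanish on the second eigenspace, then [al] on constants. *)
pose be := ((mu%:q - l1%:q) / c%:q)%R.
pose al := ((l0%:q + mu%:q - be * (p.+3%:q * N%:q)) / M%:q)%R.
have c0 : (c%:q != 0)%R by rewrite pnatr_eq0 -lt0n.
have M0 : (M%:q != 0)%R by rewrite pnatr_eq0 -lt0n.
have psd := @intersecting_quadratic_ge0 n p H mu%:q al be uH iH.
have rE : (p.+3%:q = p%:q + 3)%R by rewrite -natrD addn3.
have r1E : (p.+2%:q = p.+3%:q - 1)%R by rewrite -(natrB _ (isT : 1 <= p.+3)) subn1.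
have r2E : (p.+1%:q = p.+3%:q - 2)%R by rewrite -(natrB _ (isT : 2 <= p.+3)) subn2.
have nE : (n%:q = 2 * p%:q + 8 + s%:q)%R by rewrite -natrM -(natrD _ (2 * p) 8) -natrD -defn.
have n1E : (n.-1%:q = n%:q - 1)%R by rewrite -subn1 natrB //; lia.
have nrE : ((n - p.+3)%:q = n%:q - p.+3%:q)%R by rewrite natrB //; lia.
have := @quadratic_average_bound rat p%:q s%:q N%:q l1%:q M%:q B%:q c%:q l0%:q mu%:q
  al be #|H|%:q (\sum_v deg H v ^ 2)%:q.
rewrite -nE -rE !ler_nat !ltr0n => /(_ (ler0n _ _) (ler0n _ _) N_gt0 l1_gt0 eN) Q.
have {Q} [] :
    (p.+3%:q * #|H|%:q * N%:q - (\sum_v deg H v ^ 2)%:q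
       <= p.+3%:q * B%:q * (M%:q - #|H|%:q))%R /\
    ((#|H|%:q < N%:q)%R -> (p.+3%:q * #|H|%:q * N%:q - (\sum_v deg H v ^ 2)%:q
       < p.+3%:q * B%:q * (M%:q - #|H|%:q))%R).
  apply: Q => /=.
  - by rewrite -!natrM mulnC -binM.
  - have := congr1 (fun k => k%:q) binB; rewrite !natrM n1E mulrC => ->.
    by rewrite mulrC r1E.
  - have := congr1 (fun k => k%:q) binc; rewrite !natrM n1E nrE mulrC => ->.
    by rewrite mulrC.
  - have := congr1 (fun k => k%:q) binl0; rewrite !natrM nrE => ->.
    by rewrite mulrC.
  - have := congr1 (fun k => k%:q) binmu; rewrite !natrM r1E r2E mulrC [RHS]mulrC => <-.
    by rewrite !(natrB _ _) ?nrE //; lia.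
  - by rewrite /be divfK.
  - by rewrite /al divfK.
  - apply: psd => //; rewrite -/M -/N -/l1 -/c -/l0.
      by rewrite /be divfK // subrr.
    by rewrite natrM /al divfK // opprB addrCA subrr addr0 subrr.
rewrite -natrM -natrM -natrM -(natrB _ eM) -natrM lerBlDr ltrBlDr -natrD ler_nat ltr_nat ltr_nat.
move=> le_e lt_e; split=> // E; apply/eqP; apply: contraT => neN.
by have := lt_e _; rewrite E ltnn ltn_neqAle neN => /(_ eN).
Qed.

End Bounds.

(** * Degree sums over nonedges, and recognition of stars *)

Lemma ksets_exists (V : finType) (X : {set V}) k : k + #|X| <= #|V| ->
  exists T, T \in ksets X k.
Proof.
by move=> le_kX; apply/set0Pn; rewrite -card_gt0 card_ksets bin_gt0; lia.
Qed.

Section Ore.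
Variable n : nat.
Implicit Types (A H : {set {set 'I_n}}) (S T : {set 'I_n}) (a b v : 'I_n).

Lemma sum_degS A H : \sum_(S in A) degS H S = \sum_v deg H v * deg A v.
Proof.
under eq_bigr => S _ do rewrite /degS big_mkcond.
rewrite exchange_big; apply: eq_bigr => v _; rewrite [deg A v]deg_sum big_distrr /=.
by apply: eq_bigr => S _; case: ifP => _; rewrite ?muln1 ?muln0.
Qed.

Lemma sum_deg r H : uniform r H -> \sum_v deg H v = r * #|H|.
Proof.
move=> uH; under eq_bigr => v _ do rewrite deg_sum.
rewrite exchange_big /= mulnC -sum_nat_const; apply: eq_bigr => S SH.
by rewrite -(uH _ SH) -sum1_card [RHS]big_mkcond; apply: eq_bigr => v _; case: (v \in S).
Qed.

Lemma degSU1 H S v : v \notin S -> degS H (v |: S) = deg H v + degS H S.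
Proof. by move=> vS; rewrite /degS big_setU1. Qed.

Lemma deg_ksets0 k v : deg (ksets set0 k.+1) v = 'C(n.-1, k).
Proof. by rewrite /deg card_ksets_mem ?inE // cards0 subn0 card_ord. Qed.

(** Over the edges, [degS] sums to the squared degrees; over all sets of this size, each vertex is
    counted 'C(n.-1, k) times. *)
Lemma sum_degS_nonedges k H : uniform k.+1 H ->
  \sum_(S in ksets set0 k.+1 :\: H) degS H S + \sum_v deg H v ^ 2 =
  k.+1 * #|H| * 'C(n.-1, k).
Proof.
move=> uH; have HK : H \subset ksets set0 k.+1.
  by apply/subsetP => S; apply: uniform_ksets.
transitivity (\sum_(S in ksets set0 k.+1) degS H S).
  rewrite [RHS](big_setID H) /= (setIidPr HK) addnC; congr (_ + _).
  by rewrite sum_degS; apply: eq_bigr => v _; rewrite mulnn.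
rewrite sum_degS -sum_deg // big_distrl /=.
by apply: eq_bigr => v _; rewrite deg_ksets0.
Qed.

Lemma card_nonedges k H : uniform k H -> #|ksets set0 k :\: H| = 'C(n, k) - #|H|.
Proof.
move=> uH; have HK : H \subset ksets set0 k.
  by apply/subsetP => S; apply: uniform_ksets.
by rewrite cardsD (setIidPr HK) card_ksets cards0 subn0 card_ord.
Qed.

(** An edge [S] missing [a] would be disjoint from some edge [a |: T], as [n] leaves room for [T]
    off [S], [a] and [b]. So all edges contain [a], and the cardinality does the rest. *)
Lemma star_of_link k H a b : 2 * k.+1 + 2 <= n -> uniform k.+1 H -> intersecting H ->
  #|H| = 'C(n.-1, k) -> {in ksets (a |: (b |: set0)) k, forall T, a |: T \in H} ->
  is_star k.+1 H.
Proof.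
move=> le_n uH iH cH linkH; exists a; apply/eqP; rewrite eqEcard; apply/andP; split.
  apply/subsetP => S SH; rewrite inE (uH _ SH) eqxx /=; apply: contraT => aS.
  have [|T] := @ksets_exists _ (S :|: (a |: (b |: set0))) k.
    have := cardsU S (a |: (b |: set0)); have := cardsU1 a (b |: set0).
    have := cardsU1 b (set0 : {set 'I_n}); rewrite card_ord (uH _ SH) cards0 => -> -> ->.
    by case: (a \in _) (b \in _) => -[]; lia.
  case/ksetsP=> cT; rewrite disjointUr => /andP[dTS dTX].
  have aTH : a |: T \in H by apply: linkH; apply/ksetsP.
  have := iH _ _ aTH SH.
  by rewrite setI_eq0 disjointUl disjoints1 aS dTS.
rewrite cH -(deg_ksets0 k a) /deg; apply/subset_leq_card/subsetP => S.
by rewrite !inE => /andP[-> ->] //; rewrite -setI_eq0 setI0 eqxx.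
Qed.

(* If the degrees of [a] and [b] differ, exchanging [a] for [b] cannot lead from
   a nonedge to a nonedge, so the links of [a] and [b] cover all [k]-sets; being
   cross-intersecting, one of them is everything since the Kneser graph is
   connected. *)
Lemma star_of_constant_nonedges k H D a b :
  2 * k.+2 + 2 <= n -> uniform k.+2 H -> intersecting H -> #|H| = 'C(n.-1, k.+1) ->
  {in ksets set0 k.+2 :\: H, forall S, degS H S = D} -> deg H a != deg H b ->
  is_star k.+2 H.
Proof.
move=> le_n uH iH cH constD nab.
have neq_ab : a != b by apply: contraNneq nab => ->.
pose X := a |: (b |: set0).
have cX : #|X| = 2 by rewrite !cardsU1 !inE orbF neq_ab cards0.
have notX T : T \in ksets X k.+1 -> (a \notin T) /\ (b \notin T).
  by case/ksetsP=> _; rewrite !disjointUr !disjointx1 => /and3P[].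
have kU1 c T : c \notin T -> #|T| = k.+1 -> c |: T \in ksets set0 k.+2.
  by move=> cT cardT; apply/ksetsP; rewrite cardsU1 cT cardT -setI_eq0 setI0.
have cover T : T \in ksets X k.+1 -> (a |: T \in H) || (b |: T \in H).
  move=> kT; have [aT bT] := notX T kT; have [cT _] := ksetsP _ _ _ kT.
  apply: contraNT nab; rewrite negb_or => /andP[naT nbT].
  rewrite -(eqn_add2r (degS H T)) -!degSU1 // !constD //.
    by rewrite inE nbT kU1.
  by rewrite inE naT kU1.
(* Otherwise [b |: W] is an edge, but it is disjoint from [a |: T]. *)
have disjE T W : T \in ksets X k.+1 -> W \in ksets X k.+1 -> [disjoint T & W] ->
    a |: T \in H -> a |: W \in H.
  move=> kT kW dTW aTH; have [aT bT] := notX T kT; have [aW bW] := notX W kW.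
  case/orP: (cover W kW) => // bWH; have := iH _ _ aTH bWH.
  rewrite setI_eq0 disjointUl disjoints1 disjointUr disjointx1 in_setU1 negb_or.
  by rewrite neq_ab aW bT dTW.
have constL : {in ksets X k.+1 &, forall T W, (a |: T \in H) = (a |: W \in H)}.
  apply: ksets_swap_const => x y U neq_xy xX yX kU.
  have kx := ksetsU1 xX kU; have ky : y |: U \in ksets X k.+1.
    by apply: (@ksetsU1 _ _ _ _ x) => //; rewrite setUCA.
  (* A common neighbour [W] of [x |: U] and [y |: U] in the Kneser graph; it fits since (k+4) +
     (k+1) <= n. *)
  have [|W /ksetsP[cW]] := @ksets_exists _ (X :|: (x |: (y |: U))) k.+1.
    have [cU _] := ksetsP _ _ _ kU.
    rewrite card_ord; apply: leq_trans le_n.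
    have : #|X :|: (x |: (y |: U))| <= k + 4.
      by rewrite cardsU cX !cardsU1 cU; case: (x \in _) (y \in _) => -[]; lia.
    lia.
  rewrite disjoint_sym !disjointUl => /and4P[dX dx dy dU].
  have kW : W \in ksets X k.+1 by apply/ksetsP; rewrite disjoint_sym !disjointUl.
  have dxW : [disjoint x |: U & W] by rewrite disjointUl dx.
  have dyW : [disjoint y |: U & W] by rewrite disjointUl dy.
  transitivity (a |: W \in H); apply/idP/idP; apply: disjE => //; by rewrite disjoint_sym.
have [T0 kT0] : exists T, T \in ksets X k.+1.
  by apply: ksets_exists; rewrite cX card_ord; lia.
case: (boolP (a |: T0 \in H)) => [aT0|naT0].
  apply: (star_of_link (a := a) (b := b)) => // T kT.
  by rewrite (constL T T0).
apply: (star_of_link (a := b) (b := a)) => // T; rewrite setUCA => kT.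
have := cover T kT; rewrite (constL T T0) //.
by rewrite (negPf naT0).
Qed.

End Ore.

(** * Averaging over the nonedges, and equality *)

Theorem theorem1p4 (r n : nat) (H : {set {set 'I_n}})
    (hr : 3 <= r) (hn : 2 * r + 2 <= n)
    (hunif : uniform r H) (hint : intersecting H) :
  ore_degree r H <= r * 'C(n - 2, r - 2) /\
  (ore_degree r H = r * 'C(n - 2, r - 2) -> is_star r H).
Proof.
case: r hr hn hunif hint => [|[|[|p]]] // _ hn uH iH.
have -> : p.+3 - 2 = p.+1 by lia.
have eN := intersecting_card_le hn uH iH.
have [le_sq eq_sq] := intersecting_degree_squares hn uH iH.
have sumNE := sum_degS_nonedges uH; have cNE := card_nonedges uH.
set NE := ksets set0 p.+3 :\: H in sumNE cNE.
set B := 'C(n - 2, p.+1) in le_sq eq_sq *; set N := 'C(n.-1, p.+2) in eN le_sq eq_sq sumNE *.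
have binN : n * N = p.+3 * 'C(n, p.+3) by apply: mul_bin_diag.
have binB : n.-1 * B = p.+2 * N by rewrite /B subn2; apply: mul_bin_diag.
have N_gt0 : 0 < N by rewrite bin_gt0; lia.
(* Nonedges exist because n > r makes [N] smaller than 'C(n, p.+3). *)
have NE_gt0 : 0 < #|NE|.
  by rewrite cNE subn_gt0 (leq_ltn_trans eN) // -(ltn_pmul2l (isT : 0 < p.+3)) -binN ltn_pmul2r; lia.
have oreNE S : S \in NE -> ore_degree p.+3 H <= degS H S.
  by rewrite inE => /andP[nS /ksetsP[cS _]]; apply: ore_degree_le.
have sum_le : \sum_(S in NE) degS H S <= #|NE| * (p.+3 * B).
  by rewrite -(leq_add2r (\sum_v deg H v ^ 2)) sumNE cNE [(_ - _) * _]mulnC.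
split.
  rewrite leqNgt; apply/negP => lt_ore.
  suff : #|NE| * (p.+3 * B).+1 <= \sum_(S in NE) degS H S by nia.
  rewrite -sum_nat_const; apply: leq_sum => S /oreNE; exact: leq_trans.
move=> ore_eq.
(* Every nonedge reaches the average bound, so equality of the sums forces equality at each
   nonedge. *)
have geNE S : S \in NE -> p.+3 * B <= degS H S ?= iff (p.+3 * B == degS H S).
  by move=> SNE; split=> //; rewrite -ore_eq oreNE.
have [] := leqif_sum geNE; rewrite sum_nat_const => ge_sum.
have sumE : \sum_(S in NE) degS H S = #|NE| * (p.+3 * B).
  by apply/eqP; rewrite eqn_leq sum_le.
rewrite sumE eqxx => /esym/forall_inP constB.
have cH : #|H| = N.
  by apply: eq_sq; rewrite -sumNE sumE cNE mulnC.
(* If all degrees were equal they would be [B], so n B = r N. With (n-1) B = (r-1) N this gives B =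
   N and then n = r, which is impossible. *)
have [a [b nab]] : exists a b, deg H a != deg H b.
  suff /existsP[a /existsP[b]] : [exists a, exists b, deg H a != deg H b] by exists a, b.
  apply: contraT => /existsPn eqd.
  have [S SNE] := card_gt0P NE_gt0; pose v0 : 'I_n := Ordinal (leq_trans (isT : 0 < 2 * p.+3 + 2) hn).
  have degE v : deg H v = deg H v0.
    by have := eqd v; apply: contraNeq => nv; apply/existsP; exists v0.
  have cS : #|S| = p.+3 by move: SNE; rewrite inE => /andP[_ /ksetsP[]].
  have dB : deg H v0 = B.
    have := constB _ SNE; rewrite /degS (eq_bigr (fun=> deg H v0)) => [|v _]; last exact: degE.
    by rewrite sum_nat_const cS eqn_pmul2l // => /eqP.
  have := sum_deg uH; rewrite (eq_bigr (fun=> B)) => [|v _]; last by rewrite degE.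
  rewrite sum_nat_const card_ord cH => E.
  have : B = N by nia.
  nia.
apply: (@star_of_constant_nonedges n p.+1 H (p.+3 * B) a b) => // S SNE.
by apply/esym/eqP/constB.
Qed.
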